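(* Let $a<b<c$ be real numbers. Then there exists at least one pair $(h,p)$, with $h\in H([0,1])$ and $p=(p^-,p^+)$ a pair of probability density functions, such that the triangular fuzzy number $(a,b,c)$ belongs to the PDMF space $X_{h,p}$.
   Context: The triangular fuzzy number $(a,b,c)$ with $a<b<c$ is identified with its membership function $T:\mathbb{R}\to[0,1]$ given by $T(x)=0$ for $x\in(-\infty,a]\cup[c,+\infty)$, $T(x)=\frac{x-a}{b-a}$ for $x\in(a,b)$, $T(b)=1$, and $T(x)=\frac{c-x}{c-b}$ for $x\in(b,c)$. A left auxiliary function (LAF) on $[0,1]$ is a function $h:(0,1)\to\mathbb{R}$ which is continuous and increasing on $(0,1)$ with $\lim_{x\to0^+}h(x)=-\infty$ and $\lim_{x\to1^-}h(x)=+\infty$. $H([0,1])$ denotes the set of all LAFs on $[0,1]$. A function $q:\mathbb{R}\to\mathbb{R}$ is a probability density function (PDF) if $q(t)\ge0$ for all $t\in\mathbb{R}$ and $\int_{-\infty}^{+\infty}q(y)\,dy=1$. Given $h\in H([0,1])$, a pair $p=(p^-,p^+)$ of PDFs and reals $a\le b\le c$, put $h^-(x)=h\left(\frac{x-a}{b-a}\right)$ for $x\in(a,b)$ and $h^+(x)=h\left(\frac{c-x}{c-b}\right)$ for $x\in(b,c)$. The membership function $f_{h,p}:\mathbb{R}\to[0,1]$ with parameters $a,b,c$ is defined by $f_{h,p}(b)=1$; $f_{h,p}(x)=\int_{-\infty}^{h^-(x)}p^-(y)\,dy$ for $x\in(a,b)$; $f_{h,p}(x)=\int_{-\infty}^{h^+(x)}p^+(y)\,dy$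 for $x\in(b,c)$; and $f_{h,p}(x)=0$ for all other $x$ (that is, for $x\ne b$ with $x\le a$ or $x\ge c$). The probability density membership function (PDMF) space $X_{h,p}$ is the set of all such functions as $a\le b\le c$ vary over the reals. *)

(* Defs.v *)
From mathcomp Require Import all_boot all_order all_algebra.
From mathcomp Require Import all_classical all_reals all_analysis.
Set Implicit Arguments.
Unset Strict Implicit.
Unset Printing Implicit Defensive.
Import Order.TTheory GRing.Theory Num.Theory.
Import numFieldNormedType.Exports.
Local Open Scope classical_set_scope.
Local Open Scope ring_scope.

(* Membership functions are typed R -> R; their values lie in [0, 1] (for PDMF,
   as soon as p is a pair of PDFs). *)

Definition triangular {R : realType} (a b c : R) : R -> R := fun x =>
  if x == b then 1
  else if a < x < b then (x - a) / (b - a)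
  else if b < x < c then (c - x) / (c - b)
  else 0.

(* Left auxiliary functions on [0, 1].  They are represented by total
   functions, whose values outside ]0, 1[ are irrelevant; "increasing" is
   read strictly. *)
Definition LAF {R : realType} : set (R -> R) := [set h : R -> R |
  [/\ {in `]0, 1[, continuous h},
      {in `]0, 1[ &, {homo h : x y / x < y}},
      h x @[x --> 0^'+] --> -oo &
      h x @[x --> 1^'-] --> +oo]].

(* Measurability is required so that the Lebesgue integral is meaningful. *)
Definition PDF {R : realType} : set (R -> R) := [set q : R -> R |
  [/\ measurable_fun [set: R] q,
      forall t, 0 <= q t &
      (\int[lebesgue_measure]_y (q y)%:E = 1)%E]].

Definition PDMF {R : realType} (h : R -> R) (p : (R -> R) * (R -> R))
    (a b c : R) : R -> R := fun x =>
  if x == b then 1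
  else if a < x < b then
    \int[lebesgue_measure]_(y in `]-oo, h ((x - a) / (b - a))]) p.1 y
  else if b < x < c then
    \int[lebesgue_measure]_(y in `]-oo, h ((c - x) / (c - b))]) p.2 y
  else 0.

Definition PDMF_space {R : realType} (h : R -> R)
    (p : (R -> R) * (R -> R)) : set (R -> R) :=
  [set f : R -> R | exists a b c : R, a <= b <= c /\ f = PDMF h p a b c].

(* Main.v *)
Require Import Defs.
From mathcomp Require Import all_boot all_order all_algebra.
From mathcomp Require Import all_classical all_reals all_analysis.
From mathcomp Require Import ring.
Local Open Scope classical_set_scope.
Local Open Scope ring_scope.
Import Order.TTheory GRing.Theory Num.Theory.
Import numFieldNormedType.Exports.

(** Take for both densities the logistic density, whose cumulative distribution
    function is the sigmoid [F y = 1 / (1 + exp (- y))], and for [h] the inverse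
    of [F] on ]0, 1[.  Then [F (h t) = t], so the membership function with
    parameters a, b, c is affine on both sides of b. *)

Definition sigmoid {R : realType} (y : R) : R := (1 + expR (- y))^-1.

Definition logit {R : realType} (x : R) : R := - ln (x^-1 - 1).

(* This is the derivative of the sigmoid, in a form that is visibly even. *)
Definition logistic_pdf {R : realType} (y : R) : R := sigmoid y * sigmoid (- y).

Lemma sigmoid_gt0 {R : realType} (y : R) : 0 < sigmoid y.
Proof. by rewrite invr_gt0 addr_gt0 ?expR_gt0. Qed.

Lemma ler_sigmoid {R : realType} : {mono @sigmoid R : x y / x <= y}.
Proof.
move=> x y; rewrite /sigmoid lef_pV2 ?posrE ?addr_gt0 ?expR_gt0//.
by rewrite lerD2l ler_expR lerN2.
Qed.

(** Clear [expR y] from the denominator. This symmetry converts tail masses [1 - sigmoid t] back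
    into values of [sigmoid]. *)
Lemma sigmoidN {R : realType} (y : R) : sigmoid (- y) = 1 - sigmoid y.
Proof.
rewrite /sigmoid opprK expRN.
by field; rewrite !gt_eqF ?addr_gt0 ?expR_gt0.
Qed.

Lemma sigmoid_lt1 {R : realType} (y : R) : sigmoid y < 1.
Proof. by rewrite -subr_gt0 -sigmoidN sigmoid_gt0. Qed.

Lemma sigmoid_logit {R : realType} (x : R) : 0 < x < 1 ->
  sigmoid (logit x) = x.
Proof.
move=> /andP[x0 x1]; rewrite /sigmoid /logit opprK lnK ?posrE.
  by rewrite addrC subrK invrK.
by rewrite subr_gt0 invf_gt1.
Qed.

Lemma is_derive_sigmoid {R : realType} (y : R) :
  is_derive y 1 sigmoid (logistic_pdf y).
Proof.
have d0 : 1 + expR (- y) != 0 by rewrite gt_eqF// addr_gt0 ?expR_gt0.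
have dD : is_derive y 1 (fun z : R => 1 + expR (- z)) (- expR (- y)).
  apply: is_derive_eq.
  by rewrite add0r mul1r mulrN1.
have := @is_deriveV R (fun z : R => 1 + expR (- z)) y _ 1 d0 dD.
move=> /is_derive_eq; apply.
(* [sigmoidN] removes the factor at [- y], so [expR (- y)] is the only exponential left and the goal
   is a rational identity in it. *)
rewrite /logistic_pdf sigmoidN /sigmoid /GRing.scale /=.
by field.
Qed.

Lemma continuous_sigmoid {R : realType} : continuous (@sigmoid R).
Proof.
move=> y; apply/differentiable_continuous/derivable1_diffP.
by have [] := is_derive_sigmoid y.
Qed.

Lemma continuous_logistic_pdf {R : realType} : continuous (@logistic_pdf R).
Proof.
move=> y; apply: cvgM; first exact: continuous_sigmoid.
apply: (@continuous_comp _ _ _ -%R sigmoid); first exact: opp_continuous.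
exact: continuous_sigmoid.
Qed.

Lemma logistic_pdfN {R : realType} (y : R) : logistic_pdf (- y) = logistic_pdf y.
Proof. by rewrite /logistic_pdf opprK mulrC. Qed.

Lemma logistic_pdf_ge0 {R : realType} (y : R) : 0 <= logistic_pdf y.
Proof. by rewrite mulr_ge0// ltW// sigmoid_gt0. Qed.

Lemma cvgy_sigmoid {R : realType} : @sigmoid R y @[y --> +oo] --> (1 : R).
Proof.
have : (1 + expR (- y))^-1 @[y --> +oo] --> (1 + 0 : R)^-1.
  apply: cvgV; first by rewrite addr0 oner_neq0.
  by apply: cvgD; [exact: cvg_cst | exact: cvgr_expR].
by rewrite addr0 invr1.
Qed.

(** [sigmoid] is an antiderivative with limit 1 at +oo, so the fundamental theorem of calculus gives
    [1 - sigmoid t]. *)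
Lemma integral_logistic_pdfy {R : realType} (t : R) :
  (\int[lebesgue_measure]_(y in `[t, +oo[) (logistic_pdf y)%:E =
   (sigmoid (- t))%:E)%E.
Proof.
rewrite (@ge0_continuous_FTC2y R logistic_pdf sigmoid t 1).
- by rewrite sigmoidN EFinB.
- by move=> *; exact: logistic_pdf_ge0.
- by apply: continuous_subspaceT; exact: continuous_logistic_pdf.
- exact: cvgy_sigmoid.
- by move=> x _; have [] := is_derive_sigmoid x.
- by apply: cvg_at_right_filter; exact: continuous_sigmoid.
- by move=> x _; rewrite derive1E; apply: derive_val; exact: is_derive_sigmoid.
Qed.

Lemma integral_logistic_pdfNy {R : realType} (t : R) :
  (\int[lebesgue_measure]_(y in `]-oo, t]) (logistic_pdf y)%:E =
   (sigmoid t)%:E)%E.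
Proof.
(* The reflection y -> -y moves the left tail to [[- t, +oo[]; as the density is even, the
   right-tail formula applies at [- t]. *)
rewrite -[in LHS](opprK t) ge0_integration_by_substitutionNy.
- under eq_integral do rewrite /= logistic_pdfN.
  by rewrite integral_logistic_pdfy opprK.
- by apply: continuous_subspaceT; exact: continuous_logistic_pdf.
- by move=> *; exact: logistic_pdf_ge0.
Qed.

Lemma PDF_logistic {R : realType} : PDF (@logistic_pdf R).
Proof.
have mp : measurable_fun setT (@logistic_pdf R).
  by apply: measurable_realfun.continuous_measurable_fun; exact: continuous_logistic_pdf.
split => //; first exact: logistic_pdf_ge0.
(* By evenness the total mass is twice that of the nonnegative half-line, which is [sigmoid 0], that
   is 1/2. *)
rewrite ge0_symfun_integralT; first last.
- by move=> y /=; rewrite logistic_pdfN.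
- exact: continuous_logistic_pdf.
- exact: logistic_pdf_ge0.
rewrite -set_itvcy integral_logistic_pdfy oppr0 -EFinM.
by rewrite /sigmoid oppr0 expR0 divff.
Qed.

(** Apply the increasing function [sigmoid] to both sides. This and [logit_ge] reduce the
    monotonicity of [logit] and its limits at 0 and 1 to comparisons with values of [sigmoid]. *)
Lemma logit_le {R : realType} (x y : R) : 0 < x < 1 ->
  (logit x <= y) = (x <= sigmoid y).
Proof. by move=> x01; rewrite -ler_sigmoid sigmoid_logit. Qed.

Lemma logit_ge {R : realType} (x y : R) : 0 < x < 1 ->
  (y <= logit x) = (sigmoid y <= x).
Proof. by move=> x01; rewrite -ler_sigmoid sigmoid_logit. Qed.

Lemma LAF_logit {R : realType} : LAF (@logit R).
Proof.
split.
- move=> x; rewrite in_itv/= => /andP[x0 x1].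
  apply: cvgN; apply: continuous_cvg.
    by apply: continuous_ln; rewrite subr_gt0 invf_gt1.
  apply: cvgB; last exact: cvg_cst.
  by apply: inv_continuous; rewrite gt_eqF.
- move=> x y; rewrite !in_itv/= => x01 y01 xy.
  by rewrite ltNge logit_le// sigmoid_logit// -ltNge.
- apply/cvgrNyPle => y; near=> x.
  rewrite logit_le; last by apply/andP; split; near: x;
    [exact: nbhs_right_gt | exact: nbhs_right_lt].
  (* The bound [y] is met as soon as x is below the positive threshold [sigmoid y]; near 1 the same
     threshold works because it is less than 1. *)
  by near: x; apply: nbhs_right_le; exact: sigmoid_gt0.
- apply/cvgryPge => y; near=> x.
  rewrite logit_ge; last by apply/andP; split; near: x;
    [exact: nbhs_left_gt | exact: nbhs_left_lt].
  by near: x; apply: nbhs_left_ge; exact: sigmoid_lt1.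
Unshelve. all: end_near. Qed.

Lemma Rintegral_logistic_pdf_logit {R : realType} (t : R) : 0 < t < 1 ->
  \int[lebesgue_measure]_(y in `]-oo, logit t]) logistic_pdf y = t.
Proof.
by move=> t01; rewrite /Rintegral integral_logistic_pdfNy sigmoid_logit.
Qed.

Theorem theorem3p3 (R : realType) (a b c : R) (hab : a < b) (hbc : b < c) :
  exists (h : R -> R) (p : (R -> R) * (R -> R)),
    [/\ LAF h, PDF p.1, PDF p.2 & PDMF_space h p (triangular a b c)].
Proof.
exists logit, (logistic_pdf, logistic_pdf); split.
- exact: LAF_logit.
- exact: PDF_logistic.
- exact: PDF_logistic.
exists a, b, c; split; first by rewrite !ltW.
(* Both functions branch on the same tests, so only the two open sides remain; there the quotient
   lies strictly between 0 and 1 and the integral returns it. *)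
apply/funext => x; rewrite /triangular /PDMF; case: ifP => // _.
case: ifPn => [/andP[ax xb]|_].
  rewrite Rintegral_logistic_pdf_logit// divr_gt0 ?subr_gt0//=.
  by rewrite ltr_pdivrMr ?subr_gt0// mul1r ltrD2r.
case: ifPn => // /andP[bx xc].
rewrite Rintegral_logistic_pdf_logit// divr_gt0 ?subr_gt0//=.
by rewrite ltr_pdivrMr ?subr_gt0// mul1r ltrD2l ltrN2.
Qed.
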